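(* Let $f\in\mathbb{Z}[x]$ be a polynomial that is not of the form $a\,g(x)^2$ or $a\,x\cdot g(x)^2$ with $g\in\mathbb{Z}[x]$ and $a\in\mathbb{Z}$. For a prime number $p$, let $C_1\subseteq\mathbb{F}_p$ be the set of nonzero squares modulo $p$ and $C_{-1}\subseteq\mathbb{F}_p$ the set of non-squares modulo $p$, let $f_p:\mathbb{F}_p\to\mathbb{F}_p$, $y \bmod p\mapsto f(y)\bmod p$, be the evaluation map induced by $f$, and for $i,j\in\{1,-1\}$ let $n_{i,j}(p)$ be the cardinality of the set $f_p^{-1}(C_i)\cap C_j$. Then, with $p$ running over the primes, $$\lim_{p\to+\infty}\frac{n_{i,j}(p)}{p}=\frac14\qquad\text{for all } i,j\in\{1,-1\}.$$ *)

(* Defs.v *)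
From HB Require Import structures.
From mathcomp Require Import all_boot all_order all_algebra.
Set Implicit Arguments.
Unset Strict Implicit.
Unset Printing Implicit Defensive.
Import Order.TTheory GRing.Theory Num.Theory.
Local Open Scope ring_scope.

(* Only meaningful for p prime: otherwise 'F_p does not have p elements. *)
Definition is_square (p : nat) (y : 'F_p) : bool := [exists z : 'F_p, y == z ^+ 2].

(* The index i is only meaningful for i = 1 and i = -1. *)
Definition quad_class (p : nat) (i : int) : {set 'F_p} :=
  if i == 1 then [set y : 'F_p | y != 0 & is_square y]
  else if i == -1 then [set y : 'F_p | ~~ is_square y]
  else set0.

Definition eval_mod (p : nat) (f : {poly int}) : 'F_p -> 'F_p :=
  fun y => (map_poly intr f).[y].

Definition quad_count (f : {poly int}) (i j : int) (p : nat) : nat :=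
  #|(eval_mod f @^-1: quad_class p i) :&: quad_class p j|.

(* Main.v *)
Require Import Defs.
From HB Require Import structures.
From mathcomp Require Import all_boot all_order all_algebra all_field.
From mathcomp Require Import all_classical all_reals all_analysis.
From mathcomp Require Import zify ring lra.
Import Order.TTheory GRing.Theory Num.Theory.
Import numFieldNormedType.Exports.

(** Write chi(y) = y^h with p = 2h + 1, the quadratic character of F_p.  The
    four sets of points y with chi(f(y)) = i and chi(y) = j cover F_p up to the
    boundedly many roots of X f, and two of them together make up (almost) one
    fibre of chi(f(y)), of chi(y), or of chi(y f(y)).  So it suffices that no
    fibre of chi(g(y)), for g = f, X, X f, has more than p/2 + o(p) points: this
    bounds each of the four sets by p/4 + o(p), and since they add up to p + O(1)
    each of them then has p/4 + o(p) points.

    The fibres of chi(y) have at most h points.  For g = f and g = X f the bound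
    is the elementary case y^2 = g(x) of the Riemann hypothesis for curves, in
    the weak form that Stepanov's method gives with a fixed number of parameters.
    One constructs a polynomial
      r = sum over j < J of (g^M P_j + g^(M+h) Q_j) (X - x0)^(jp),
    with P_j and Q_j of degree less than A, about p/2, whose derivatives of order
    less than M all vanish at every x with g(x)^h = a.  At such x one has
    g^h = a and (x - x0)^p = x - x0, so the l-th derivative of r at x is a power
    of g(x) times the value of a polynomial of low degree; requiring these
    polynomials to be zero is a linear system with about M p/2 equations
    in 2JA, about J p, unknowns, and M = 2J - 1 is affordable for large p
    (exists_auxiliary_pair).  The polynomial r is not zero: otherwise the least j
    with P_j or Q_j nonzero gives (X - x0)^p | P_j + g^h Q_j, hence
    (X - x0)^p | g P_j^2 - g(x0)^p Q_j^2, which has degree less than p, so that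
    g P_j^2 = c Q_j^2 (two_term_sum_eq0).  Comparing M times the number of points
    with the degree of r, about J p + O(p), gives p/2 + O(p/J) points
    (stepanov_bound, card_power_fiber_le).

    What Stepanov's method needs is that g P^2 = c Q^2 has no solution with P
    nonzero over F_p.  If f is not an integer times a square, then some multiple
    N f is s h^2 with s separable of positive degree (separable_part), and a
    Bezout identity u s + v s' = D shows that s stays separable modulo all
    large p; infinite descent then excludes s H^2 = c Q^2
    (separable_not_scaled_square).  The same applies to X f: if X f = a g^2 then
    X divides g, so f would be a X times a square. *)

Set Implicit Arguments.
Unset Strict Implicit.
Unset Printing Implicit Defensive.
Local Open Scope ring_scope.

(** * Derivatives of a power times a cofactor, and roots of high multiplicity *)

(** The cofactor left by l derivations of f^n P once f^(n-l) is factored out.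
    Its size grows by at most the size of f at each step, however large n is;
    this is why the factor f^h of degree about p/2 is harmless later on. *)
Fixpoint exp_deriv (R : nzSemiRingType) (f : {poly R}) (n l : nat) (P : {poly R}) :=
  if l is l'.+1 then
    let E := exp_deriv f n l' P in f^`() * E *+ (n - l') + f * E^`()
  else P.

Lemma derivn_exp_mul (R : comNzRingType) (f P : {poly R}) n l :
  (l <= n)%N -> (f ^+ n * P)^`(l) = f ^+ (n - l) * exp_deriv f n l P.
Proof.
elim: l => [|l IH] ln; first by rewrite derivn0 subn0.
rewrite derivnS IH 1?ltnW // derivM deriv_exp /=.
set E := exp_deriv f n l P.
have -> : (n - l = (n - l.+1).+1)%N by lia.
by rewrite -pred_Sn exprS !mulrnAl mulrDr mulrnAr; congr (_ *+ _ + _); ring.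
Qed.

Lemma exp_derivB (R : nzRingType) (f : {poly R}) n l :
  {morph exp_deriv f n l : P Q / P - Q}.
Proof.
elim: l => //= l IH P Q; rewrite IH derivB !mulrBr mulrnBl.
by rewrite addrACA opprD.
Qed.

Lemma leq_size_deriv (R : nzSemiRingType) (P : {poly R}) :
  (size P^`() <= (size P).-1)%N.
Proof. by rewrite /deriv size_poly. Qed.

Lemma size_exp_deriv (R : nzSemiRingType) (f P : {poly R}) n l :
  (size (exp_deriv f n l P) <= size P + l * size f)%N.
Proof.
elim: l => [|l IH] /=; first by rewrite addn0.
move: (exp_deriv f n l P) IH => E IH.
rewrite (leq_trans (size_polyD _ _)) // geq_max; apply/andP; split.
  rewrite -scaler_nat (leq_trans (size_scale_leq _ _)) // (leq_trans (size_polyMleq _ _)) //.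
  by have := leq_size_deriv f; rewrite mulSn; lia.
rewrite (leq_trans (size_polyMleq _ _)) //.
by have := leq_size_deriv E; rewrite mulSn; lia.
Qed.

(** At a root of f only the term f' E of the recursion survives; for f = X - x
    and l = n this computes the l-th derivative at x of (X - x)^l P. *)
Lemma horner_exp_deriv_root (R : comNzRingType) (f P : {poly R}) n l x :
  f.[x] = 0 ->
  (exp_deriv f n l P).[x] = (f^`().[x] ^+ l * P.[x]) *+ n ^_ l.
Proof.
move=> fx; elim: l => [|l IH]; first by rewrite /= expr0 mul1r.
rewrite /= !hornerE hornerMn !hornerE fx IH ffactnSr exprS mulrnAr -mulrnA.
by rewrite mulrA mul0r addr0.
Qed.

(** Vanishing derivatives detect multiplicity as long as M! is invertible, which
    the first hypothesis expresses. *)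
Lemma dvdp_XsubC_exp_derivn (F : fieldType) (r : {poly F}) x M :
  (forall n, (0 < n < M)%N -> n%:R != 0 :> F) ->
  (forall l, (l < M)%N -> r^`(l).[x] = 0) ->
  ('X - x%:P) ^+ M %| r.
Proof.
elim: M => [|M IH] Mchar rx; first by rewrite expr0 dvd1p.
have /dvdpP[q Er] : ('X - x%:P) ^+ M %| r.
  apply: IH => [n /andP[n0 nM]|l lM]; last by rewrite rx // leqW.
  by rewrite Mchar // n0 leqW.
have := rx M (ltnSn M); rewrite Er mulrC derivn_exp_mul // subnn expr0 mul1r.
rewrite horner_exp_deriv_root ?hornerXsubC ?subrr // derivXsubC hornerC expr1n mul1r.
rewrite ffactnn -mulr_natr => /eqP; rewrite mulf_eq0 => /orP[qx|]; last first.
  have nz k : (k <= M)%N -> k`!%:R != 0 :> F.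
    elim: k => [|k IHk] kM; first by rewrite oner_eq0.
    by rewrite factS natrM mulf_neq0 ?IHk 1?ltnW // Mchar /=.
  by rewrite (negPf (nz _ _)).
by rewrite exprSr dvdp_mul2l ?expf_neq0 ?polyXsubC_eq0 // dvdp_XsubCl.
Qed.

Lemma prod_XsubC_exp_dvdp (F : fieldType) (s : seq F) (r : {poly F}) M :
  uniq s -> {in s, forall x, ('X - x%:P) ^+ M %| r} ->
  \prod_(x <- s) ('X - x%:P) ^+ M %| r.
Proof.
elim: s => [|x s IH] /=; first by rewrite big_nil dvd1p.
case/andP=> xs us sr; rewrite big_cons Gauss_dvdp.
  by rewrite sr ?mem_head // IH // => y ys; rewrite sr // inE ys orbT.
rewrite big_seq; apply: (big_ind (coprimep _)) => [|P Q cP cQ|y ys].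
- exact: coprimep1.
- by rewrite coprimepMr cP.
apply/coprimep_expl/coprimep_expr/coprimep_XsubC2; rewrite subr_eq0.
by apply: contraNneq xs => <-.
Qed.

Lemma card_high_roots (F : finFieldType) (S : {set F}) (r : {poly F}) M :
  r != 0 -> {in S, forall x, ('X - x%:P) ^+ M %| r} -> (#|S| * M < size r)%N.
Proof.
move=> r0 Sr.
have /dvdp_leq -/(_ r0) : \prod_(x <- enum S) ('X - x%:P) ^+ M %| r.
  by apply: prod_XsubC_exp_dvdp (enum_uniq _) _ => x; rewrite mem_enum; apply: Sr.
rewrite prodrXl; set Q := \prod_(x <- _) _ => leQr.
have Q0 : Q ^+ M != 0 by rewrite expf_neq0 // monic_neq0 // monic_prod_XsubC.
rewrite (leq_trans _ leQr) // -(prednK (n := size (Q ^+ M))) ?size_poly_gt0 //.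
by rewrite size_exp /Q size_prod_XsubC -cardE.
Qed.

(** * Non-vanishing of sums of terms P + f^h Q *)

(** This says that f is not a constant times a square in the field F(X), with
    denominators cleared. *)
Definition not_scaled_square (F : fieldType) (f : {poly F}) :=
  forall (c : F) (P Q : {poly F}), P != 0 -> f * P ^+ 2 <> c *: Q ^+ 2.

Lemma dvdp_XsubC_exp_Frobenius (F : fieldType) (f : {poly F}) (x : F) p :
  p \in [pchar F] -> ('X - x%:P) ^+ p %| f ^+ p - (f.[x] ^+ p)%:P.
Proof.
move=> pF; have pP : p \in [pchar {poly F}] by rewrite pchar_poly.
rewrite polyC_exp -(pFrobenius_autE pP) -(pFrobenius_autE pP f).
rewrite -(pFrobenius_autE pP f.[x]%:P) -rmorphB !pFrobenius_autE dvdp_exp2r //.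
by rewrite dvdp_XsubCl rootE !hornerE subrr.
Qed.

(** Multiplying P + f^h Q by f (P - f^h Q) gives f P^2 - f^p Q^2, and modulo
    (X - x0)^p the power f^p is the constant f(x0)^p by Frobenius.  The remaining
    f P^2 - c Q^2 is too small to be divisible by (X - x0)^p unless it is zero. *)
Lemma dvdp_two_term_eq0 (F : fieldType) (f P Q : {poly F}) (x0 : F) p h A :
  p \in [pchar F] -> p = h.*2.+1 -> f.[x0] != 0 -> not_scaled_square f ->
  (size f + A.*2 <= p.+1)%N -> (size P <= A)%N -> (size Q <= A)%N ->
  ('X - x0%:P) ^+ p %| P + f ^+ h * Q -> P = 0 /\ Q = 0.
Proof.
move=> pF ph fx0 nsf szA sP sQ dv.
set Y := 'X - x0%:P in dv; set c := f.[x0] ^+ p.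
have c0 : c != 0 by rewrite expf_neq0.
have dv2 : Y ^+ p %| f * P ^+ 2 - c *: Q ^+ 2.
  have -> : f * P ^+ 2 - c *: Q ^+ 2 =
      (P + f ^+ h * Q) * (f * (P - f ^+ h * Q)) + (f ^+ p - c%:P) * Q ^+ 2.
    by rewrite ph [f ^+ _.+1]exprS -mul2n mulnC exprM -mul_polyC; ring.
  by rewrite dvdp_add ?dvdp_mulr // dvdp_XsubC_exp_Frobenius.
have eq0 : f * P ^+ 2 - c *: Q ^+ 2 = 0.
  apply/eqP; apply/negP => /negP nz; have := dvdp_leq nz dv2; apply/negP.
  rewrite size_exp_XsubC -ltnNge ltnS (leq_trans (size_polyD _ _)) // geq_max.
  have f0 : (0 < size f)%N.
    by rewrite size_poly_gt0; apply: contraNneq fx0 => ->; rewrite horner0.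
  have sz2 (T : {poly F}) : (size T <= A)%N -> (size (T ^+ 2) <= A.*2.-1)%N.
    by rewrite expr2 => sT; have := size_polyMleq T T; lia.
  rewrite size_polyN; apply/andP; split.
    rewrite (leq_trans (size_polyMleq _ _)) //.
    by move: (size f) (size (P ^+ 2)) f0 szA (sz2 _ sP) => a b; lia.
  by rewrite (leq_trans (size_scale_leq _ _)) // (leq_trans (sz2 _ sQ)) //; lia.
have [P0|/nsf nz] := eqVneq P 0; last by case: (nz c Q); apply/eqP; rewrite -subr_eq0 eq0.
split=> //; apply/eqP; move/eqP: eq0; rewrite P0 expr0n mulr0 add0r oppr_eq0.
by rewrite scaler_eq0 (negPf c0) expf_eq0.
Qed.

(** The term j = 0 is the sum of the others up to sign, hence divisible by
    (X - x0)^p, hence zero; dividing by (X - x0)^p, one goes on with j = 1. *)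
Lemma two_term_sum_eq0 (F : fieldType) (f : {poly F}) (x0 : F) p h A J
    (P Q : nat -> {poly F}) :
  p \in [pchar F] -> p = h.*2.+1 -> f.[x0] != 0 -> not_scaled_square f ->
  (size f + A.*2 <= p.+1)%N ->
  (forall j, (size (P j) <= A)%N) -> (forall j, (size (Q j) <= A)%N) ->
  \sum_(j < J) (P j + f ^+ h * Q j) * ('X - x0%:P) ^+ (j * p) = 0 ->
  forall j, (j < J)%N -> P j = 0 /\ Q j = 0.
Proof.
move=> pF ph fx0 nsf szA; elim: J P Q => [|J IH] P Q sP sQ //.
rewrite big_ord_recl mul0n expr0 mulr1 => sum0.
set Y := 'X - x0%:P in sum0.
pose W := \sum_(j < J) (P j.+1 + f ^+ h * Q j.+1) * Y ^+ (j * p).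
have EW : P 0%N + f ^+ h * Q 0%N + Y ^+ p * W = 0.
  rewrite -[RHS]sum0; congr (_ + _); rewrite mulr_sumr; apply: eq_bigr => j _.
  by rewrite /= mulrCA -exprD -mulSn.
have [P0 Q0] : P 0%N = 0 /\ Q 0%N = 0.
  apply: (dvdp_two_term_eq0 (x0 := x0) pF ph fx0 nsf szA) => //.
  by move/eqP: EW; rewrite addr_eq0 => /eqP ->; rewrite dvdpNr dvdp_mulr.
case=> // j; rewrite ltnS; apply: (IH (P \o S) (Q \o S)) => [k|k|] //=.
apply/eqP; move/eqP: EW; rewrite P0 Q0 mulr0 !add0r mulf_eq0 expf_eq0 polyXsubC_eq0.
by rewrite andbF.
Qed.

(** * Stepanov's auxiliary polynomial *)

(** A p-th power is a constant for derivations in characteristic p. *)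
Lemma derivn_mul_pexp (R : comNzRingType) (G H : {poly R}) p j l :
  p \in [pchar R] -> (G * H ^+ (j * p))^`(l) = G^`(l) * H ^+ (j * p).
Proof.
move=> pR; elim: l => [|l IH]; first by rewrite !derivn0.
rewrite !derivnS IH derivM deriv_exp.
have -> : (H^`() * H ^+ (j * p).-1) *+ (j * p) = 0.
  have pX : p \in [pchar {poly R}] by rewrite pchar_poly.
  by rewrite mulnC mulrnA (mulrn_pchar pX) mul0rn.
by rewrite mulr0 addr0.
Qed.

(** Over a finite field counting replaces the rank argument for a linear system
    with more unknowns than equations. *)
Lemma additive_pigeonhole (U V : finZmodType) (phi : U -> V) :
  {morph phi : u v / u - v} -> (#|V| < #|U|)%N ->
  exists2 u, u != 0 & phi u = 0.
Proof.
move=> phiB ltVU.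
have /injectivePn[u [v uv euv]] : ~~ injectiveb phi.
  by apply: contraL ltVU => /injectiveP/leq_card; rewrite -leqNgt.
by exists (u - v); rewrite ?subr_eq0 // phiB euv subrr.
Qed.

(** The coefficient rows of a matrix as a family of polynomials indexed by nat,
    zero beyond the last row: the induction of two_term_sum_eq0 shifts the
    index, which is awkward with ordinals. *)
Definition row_poly (F : fieldType) (n A : nat) (u : 'M[F]_(n, A)) (k : nat) : {poly F} :=
  if insub k is Some i then rVpoly (row i u) else 0.

Lemma row_polyB (F : fieldType) n A k :
  {morph (fun u : 'M[F]_(n, A) => row_poly u k) : u v / u - v}.
Proof.
by move=> u v; rewrite /row_poly; case: insub => [i|]; rewrite ?subr0 // !linearB.
Qed.

Lemma size_row_poly (F : fieldType) n A (u : 'M[F]_(n, A)) k :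
  (size (row_poly u k) <= A)%N.
Proof. by rewrite /row_poly; case: insub => [i|]; rewrite ?size_poly0 ?size_poly. Qed.

Lemma row_poly_eq0 (F : fieldType) n A (u : 'M[F]_(n, A)) :
  (forall k, (k < n)%N -> row_poly u k = 0) -> u = 0.
Proof.
move=> u0; apply/row_matrixP => i; rewrite row0.
have := u0 i (ltn_ord i); rewrite /row_poly valK => /(congr1 (@poly_rV _ A)).
by rewrite rVpolyK linear0.
Qed.

(** Up to a power of f, the value at x of the l-th derivative of the auxiliary
    polynomial, after the substitutions f(x)^h = a and (x - x0)^p = x - x0. *)
Definition stepanov_residue (F : fieldType) (f : {poly F}) (a x0 : F) h J M
    (P Q : nat -> {poly F}) (l : nat) : {poly F} :=
  \sum_(j < J) (exp_deriv f M l (P j) + a *: exp_deriv f (M + h) l (Q j))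
               * ('X - x0%:P) ^+ j.

(** The left side of the hypothesis counts the coefficients of the M residues,
    the right side those of the 2J polynomials P_j and Q_j. *)
Lemma exists_auxiliary_pair (F : finFieldType) (f : {poly F}) (a x0 : F) h J M A :
  (M * (A + M * size f + J) < J.*2 * A)%N ->
  exists P Q : nat -> {poly F},
  [/\ forall j, (size (P j) <= A)%N /\ (size (Q j) <= A)%N,
      exists2 j, (j < J)%N & ~ (P j = 0 /\ Q j = 0)
    & forall l, (l < M)%N -> stepanov_residue f a x0 h J M P Q l = 0].
Proof.
move=> ltMA; pose N := (A + M * size f + J)%N.
pose PP (u : 'M[F]_(J + J, A)) := row_poly u.
pose QQ (u : 'M[F]_(J + J, A)) j := row_poly u (J + j).
pose cond u l := stepanov_residue f a x0 h J M (PP u) (QQ u) l.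
pose phi u : 'M[F]_(M, N) := \matrix_(l, b) (cond u l)`_b.
have condB u v l : cond (u - v) l = cond u l - cond v l.
  rewrite /cond /stepanov_residue -sumrB; apply: eq_bigr => j _.
  by rewrite /PP /QQ !row_polyB !exp_derivB scalerBr -mulrBl opprD addrACA.
have size_cond u l : (l < M)%N -> (size (cond u l) <= N)%N.
  move=> lM; rewrite /cond /stepanov_residue (leq_trans (size_sum _ _ _)) //.
  apply/bigmax_leqP => j _; rewrite (leq_trans (size_polyMleq _ _)) //.
  have szE n (T : {poly F}) : (size T <= A)%N ->
      (size (exp_deriv f n l T) <= A + M * size f)%N.
    move=> sT; rewrite (leq_trans (size_exp_deriv _ _ _ _)) // leq_add //.
    by rewrite leq_mul2r ltnW ?orbT.
  rewrite size_exp_XsubC addnS /= /N leq_add ?(ltnW (ltn_ord j)) //.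
  rewrite (leq_trans (size_polyD _ _)) // geq_max szE ?size_row_poly //=.
  by rewrite (leq_trans (size_scale_leq _ _)) // szE ?size_row_poly.
have [||u u0 phiu0] := @additive_pigeonhole _ _ phi.
- by move=> u v; apply/matrixP => l b; rewrite !mxE condB coefB.
- by rewrite !card_mx ltn_exp2l ?finNzRing_gt1 // -/N addnn.
exists (PP u), (QQ u); split=> [j|| l lM]; first by rewrite !size_row_poly.
- have [/existsP[j nz]|/existsPn nex] :=
      boolP [exists j : 'I_J, (PP u j != 0) || (QQ u j != 0)].
    exists j => // -[Pj Qj]; move: nz.
    by rewrite Pj Qj eqxx.
  case/eqP: u0; apply: row_poly_eq0 => k kJ.
  have [ltkJ|leJk] := ltnP k J.
    by have := nex (Ordinal ltkJ); rewrite negb_or !negbK => /andP[/eqP].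
  have ltkJ : (k - J < J)%N by rewrite ltn_subLR.
  have := nex (Ordinal ltkJ); rewrite negb_or !negbK => /andP[_ /eqP].
  by rewrite /QQ /= subnKC.
apply/polyP => b; rewrite coef0; have [bN|Nb] := ltnP b N; last first.
  by rewrite nth_default // (leq_trans _ Nb) ?size_cond.
by have /matrixP/(_ (Ordinal lM) (Ordinal bN)) := phiu0; rewrite !mxE.
Qed.

Definition stepanov_poly (F : fieldType) (f : {poly F}) (x0 : F) (p h J M : nat)
    (P Q : nat -> {poly F}) : {poly F} :=
  \sum_(j < J) (f ^+ M * P j + f ^+ (M + h) * Q j) * ('X - x0%:P) ^+ (j * p).

Lemma stepanov_poly_derivn_horner (F : finFieldType) (f : {poly F}) (a x0 x : F) h J M P Q l :
  #|F| \in [pchar F] -> f.[x] ^+ h = a -> (l < M)%N ->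
  (stepanov_poly f x0 #|F| h J M P Q)^`(l).[x] =
    f.[x] ^+ (M - l) * (stepanov_residue f a x0 h J M P Q l).[x].
Proof.
move=> pF fxa lM; rewrite /stepanov_poly /stepanov_residue linear_sum /= !horner_sum mulr_sumr.
apply: eq_bigr => j _.
rewrite derivn_mul_pexp // derivnD !derivn_exp_mul ?(ltnW lM) //; last first.
  by rewrite ltnW ?ltn_addr.
rewrite -addnBAC 1?ltnW // exprD !hornerE fxa mulnC exprM expf_card.
by rewrite /=; ring.
Qed.

Lemma size_stepanov_poly (F : fieldType) (f : {poly F}) (x0 : F) p h J M A
    (P Q : nat -> {poly F}) :
  (forall j, (size (P j) <= A)%N /\ (size (Q j) <= A)%N) ->
  (size (stepanov_poly f x0 p h J M P Q) <= (M + h) * size f + A + J * p)%N.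
Proof.
move=> sPQ; rewrite (leq_trans (size_sum _ _ _)) //; apply/bigmax_leqP => j _.
have [sP sQ] := sPQ j.
have szE n (T : {poly F}) : (n <= M + h)%N -> (size T <= A)%N ->
    (size (f ^+ n * T)%R <= (M + h) * size f + A)%N.
  move=> nM sT; rewrite (leq_trans (size_polyMleq _ _)) //.
  have := size_poly_exp_leq f n.
  have : ((size f).-1 * n <= (M + h) * size f)%N by rewrite mulnC leq_mul ?leq_pred.
  by move: ((size f).-1 * n)%N (_ * _)%N (size (f ^+ n)) => b c d; lia.
rewrite (leq_trans (size_polyMleq _ _)) // size_exp_XsubC addnS /=.
rewrite leq_add ?leq_mul2r ?(ltnW (ltn_ord j)) ?orbT //.
by rewrite (leq_trans (size_polyD _ _)) // geq_max !szE ?leq_addr.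
Qed.

Definition power_fiber (F : finFieldType) (g : {poly F}) (h : nat) (c : F) : {set F} :=
  [set x | g.[x] ^+ h == c].
Arguments power_fiber {F} g%_ring_scope h%_nat_scope c%_ring_scope.

(** Each point of the fibre is a root of multiplicity at least M of a nonzero
    polynomial whose degree is bounded by the right side. *)
Lemma stepanov_bound (F : finFieldType) (f : {poly F}) (a : F) h J M A :
  prime #|F| -> #|F| = h.*2.+1 -> not_scaled_square f ->
  (size f + A.*2 <= #|F|.+1)%N -> (0 < A)%N -> (M <= #|F|)%N ->
  (M * (A + M * size f + J) < J.*2 * A)%N ->
  (#|power_fiber f h a| * M <= (M + h) * size f + A + J * #|F|)%N.
Proof.
move=> pr Fh nsf szA A0 MF ltMA.
have pF : #|F| \in [pchar F] by apply: (card_finPcharP (n := 1)); rewrite ?expn1.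
have f0 : f != 0.
  apply/eqP => f0; apply: (nsf 0 1 0); first exact: oner_neq0.
  by rewrite f0 mul0r scale0r.
have [x0 fx0] : exists x0, f.[x0] != 0.
  apply/existsP; apply: contraLR szA; rewrite negb_exists => /forallP rt.
  have rtF : all (root f) (enum F) by apply/allP => x _; rewrite -[root f x]negbK rt.
  have := max_poly_roots f0 rtF (enum_uniq _); rewrite -cardE.
  by move: (size f) #|F| => s q; lia.
have [P [Q [sPQ [j jJ nz] cond]]] := exists_auxiliary_pair a x0 h ltMA.
pose r := stepanov_poly f x0 #|F| h J M P Q.
have r0 : r != 0.
  apply/eqP => r0; apply: nz; move: j jJ.
  have sP j : (size (P j) <= A)%N by case: (sPQ j).
  have sQ j : (size (Q j) <= A)%N by case: (sPQ j).
  apply: (two_term_sum_eq0 (x0 := x0) pF Fh fx0 nsf szA) => //.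
  set S := \sum_(j < J) _; have : f ^+ M * S = 0.
    rewrite -[RHS]r0 /r /stepanov_poly mulr_sumr; apply: eq_bigr => j _.
    by rewrite mulrA mulrDr mulrA -exprD.
  by move/eqP; rewrite mulf_eq0 expf_eq0 (negPf f0) andbF => /eqP.
rewrite (leq_trans _ (size_stepanov_poly f x0 _ h J M sPQ)) // ltnW //.
apply: card_high_roots r0 _ => x; rewrite inE => /eqP fxa.
apply: dvdp_XsubC_exp_derivn => [n /andP[n0 nM]|l lM].
  rewrite -(dvdn_pcharf pF); apply/negP => /(dvdn_leq n0).
  by rewrite leqNgt (leq_trans nM).
by rewrite (stepanov_poly_derivn_horner (a := a)) // cond // horner0 mulr0.
Qed.

(** * Fibres of the quadratic character of a polynomial *)

(** The bound p/2 + p/(2K): the natural number K stands for the inverse of the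
    tolerance, and how large p must be depends only on K and the degree. *)
Lemma card_power_fiber_le m K : exists N : nat,
  forall (F : finFieldType) (f : {poly F}) (a : F) h,
  prime #|F| -> #|F| = h.*2.+1 -> (N <= #|F|)%N -> (size f <= m)%N ->
  not_scaled_square f ->
  (K * #|power_fiber f h a|.*2 <= K.+1 * #|F|)%N.
Proof.
(* M = 2J - 1 > K (m + 3): the error term (m + 3) p / M is then at most p / K. *)
have [J [M [MJ KM]]] : exists J M, (J.*2 = M.+1 /\ K * (m + 3) < M)%N.
  by exists (K * (m + 3)).+1, (K * (m + 3)).*2.+1; split=> //; lia.
exists ((M * (M * m + J)).*2 + (M * m).*2 + m + M + 3)%N => F f a h pr Fh leN sf nsf.
(* The largest A that the non-vanishing argument allows when size f = m. *)
pose A := ((#|F|.+1 - m)./2).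
have [A1 A2] : (m + A.*2 <= #|F|.+1 /\ #|F| <= m + A.*2)%N.
  by rewrite /A; move: leN; move: #|F| (M * _)%N (M * _)%N => q x y; lia.
have step : (M * (A + M * size f + J) < J.*2 * A)%N.
  rewrite MJ mulSn -addnA mulnDr.
  have : (M * (M * size f + J) <= M * (M * m + J))%N.
    by rewrite leq_mul // leq_add // leq_mul.
  move: leN A1 A2; move: (M * (M * m + J))%N (M * (M * size f + J))%N => y x.
  by move: (M * A)%N (M * m)%N #|F| => z t q; lia.
have := @stepanov_bound F f a h J M A pr Fh nsf _ _ _ step.
move: #|power_fiber f h a| => S bnd.
have {}bnd : (S * M <= (M + h) * m + A + J * #|F|)%N.
  rewrite (leq_trans (bnd _ _ _)) ?leq_add ?leq_mul //; lia.
have bnd2 : (S.*2 * M <= M * #|F| + (m + 3) * #|F|)%N.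
  have hF : ((h * m).*2 <= #|F| * m)%N by rewrite doubleMl leq_mul2r Fh leqnSn orbT.
  have JF : ((J * #|F|).*2 = M * #|F| + #|F|)%N by rewrite doubleMl MJ mulSn addnC.
  have {leN}: ((M * m).*2 < #|F|)%N by apply: leq_trans leN; lia.
  rewrite -doubleMl mulnDl; move: bnd hF JF A1; rewrite mulnDl.
  move: (S * M)%N (M * m)%N (h * m)%N (J * _)%N (M * #|F|)%N => a1 a2 a3 a4 a5.
  by rewrite mulnC; move: (#|F| * m)%N #|F| => a7 q; lia.
have M0 : (0 < M)%N by case: (M) KM.
rewrite -(leq_pmul2r M0); apply: (@leq_trans (K * (M * #|F| + (m + 3) * #|F|))%N).
  by rewrite -mulnA leq_mul.
have KMF : (K * (m + 3) * #|F| <= M * #|F|)%N by rewrite leq_mul2r ltnW ?orbT.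
rewrite mulnDr [X in (_ + X)%N]mulnA mulSn mulnDl addnC.
by apply: leq_add; [rewrite [leqRHS]mulnC | rewrite -mulnA [(#|F| * M)%N]mulnC].
Qed.

Lemma exp_half_sqr (F : finFieldType) h (x : F) :
  #|F| = h.*2.+1 -> x != 0 -> (x ^+ h) ^+ 2 = 1.
Proof.
move=> Fh x0; apply: (mulfI x0).
by rewrite mulr1 -exprM muln2 -exprS -Fh expf_card.
Qed.

Lemma exp_half_pm1 (F : finFieldType) h (x : F) :
  #|F| = h.*2.+1 -> x != 0 -> (x ^+ h == 1) || (x ^+ h == -1).
Proof. by move=> Fh x0; rewrite -sqrf_eq1 (exp_half_sqr Fh). Qed.

Lemma card_power_fiberX_le (F : finFieldType) h (a : F) :
  (0 < h)%N -> (#|power_fiber 'X h a| <= h)%N.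
Proof.
move=> h0; set S := power_fiber _ _ _.
have p0 : 'X^h - a%:P != 0 :> {poly F} by rewrite -size_poly_gt0 size_XnsubC.
have rt : all (root ('X^h - a%:P)) (enum S).
  by apply/allP => x; rewrite mem_enum inE rootE !hornerE subr_eq0.
by have := max_poly_roots p0 rt (enum_uniq _); rewrite -cardE size_XnsubC.
Qed.

(** The nonzero squares are roots of X^h - 1, which has at most h roots; since
    squaring is at most two-to-one on the 2h nonzero elements, there are at least
    h of them, so the two sets agree. *)
Lemma euler_criterion (F : finFieldType) h (y : F) :
  (0 < h)%N -> #|F| = h.*2.+1 ->
  (y ^+ h == 1) = (y != 0) && [exists z : F, y == z ^+ 2].
Proof.
move=> h0 Fh; pose Sq := [set y : F | (y != 0) && [exists z : F, y == z ^+ 2]].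
pose R := power_fiber 'X h (1 : F).
suff ESR : Sq = R by have /setP/(_ y) := ESR; rewrite !inE hornerX => ->.
have SqR : Sq \subset R.
  apply/fintype.subsetP => x; rewrite !inE hornerX => /andP[x0 /existsP[z /eqP Ex]].
  have z0 : z != 0 by apply: contraNneq x0 => z0; rewrite Ex z0 expr0n.
  by rewrite Ex exprAC (exp_half_sqr Fh).
apply/eqP; rewrite eqEcard SqR (leq_trans (card_power_fiberX_le 1 h0)) //.
rewrite -leq_double; have -> : h.*2 = #|[set~ 0 : F]| by rewrite cardsC1 Fh.
rewrite -sum1_card (partition_big (fun z : F => z ^+ 2) (mem Sq)) /=; last first.
  move=> z; rewrite !inE expf_eq0 /= => -> /=.
  by apply/existsP; exists z.
(* The fibre of the squaring map over z^2 is contained in {z, -z}. *)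
rewrite -muln2 -sum_nat_const; apply: leq_sum => x.
rewrite inE => /andP[_ /existsP[z /eqP Ex]].
have c2 : (#|[set z; - z]| <= 2)%N by rewrite cards2; case: (z == _).
rewrite sum1_card (leq_trans _ c2) // subset_leq_card //; apply/fintype.subsetP => t.
by rewrite !inE => /andP[_]; rewrite Ex eqf_sqr.
Qed.

Lemma oner_neqN1_odd_card (F : finFieldType) h :
  prime #|F| -> #|F| = h.*2.+1 -> (1 == -1 :> F) = false.
Proof.
move=> pr Fh; apply/negP => /eqP e1.
have := pcharf0 (card_finPcharP (F := F) (n := 1) (esym (expn1 _)) pr).
rewrite Fh -addn1 natrD -mul2n natrM [2%:R]mulrS {1}e1 addNr mul0r add0r.
by apply/eqP/oner_neq0.
Qed.

Lemma cards_disjoint_le (T : finType) (A B C : {set T}) :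
  A \subset C -> B \subset C -> [disjoint A & B] -> (#|A| + #|B| <= #|C|)%N.
Proof.
move=> AC BC /disjoint_setI0 dAB; rewrite -cardsUI dAB cards0 addn0.
by rewrite subset_leq_card // finset.subUset AC.
Qed.

Definition quadrant (F : finFieldType) (h : nat) (f : {poly F}) (a b : F) : {set F} :=
  power_fiber f h a :&: power_fiber 'X h b.
Arguments quadrant {F} h f%_ring_scope a%_ring_scope b%_ring_scope.

(** Two quadrants that share the value of chi(f(x)), of chi(x), or of their
    product lie in one fibre; chi is multiplicative, so the product is chi(x f(x)). *)
Lemma quadrant_sum_le (F : finFieldType) h (f : {poly F}) (a b : F) :
  prime #|F| -> #|F| = h.*2.+1 -> a ^+ 2 = 1 -> b ^+ 2 = 1 ->
  [/\ (#|quadrant h f a b| + #|quadrant h f a (- b)| <= #|power_fiber f h a|)%N,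
      (#|quadrant h f a b| + #|quadrant h f (- a) b| <= #|power_fiber 'X h b|)%N
    & (#|quadrant h f a b| + #|quadrant h f (- a) (- b)|
         <= #|power_fiber ('X * f) h (a * b)|)%N].
Proof.
move=> pr Fh a2 b2.
have neqN (c : F) : c ^+ 2 = 1 -> (c == - c) = false.
  have e1 := oner_neqN1_odd_card pr Fh.
  by move/eqP; rewrite sqrf_eq1 => /orP[]/eqP->; rewrite ?opprK // eq_sym.
split; apply: cards_disjoint_le;
  try (apply/fintype.subsetP => x; rewrite !inE ?hornerX => /andP[/eqP fx /eqP xx]).
- by rewrite fx.
- by rewrite fx.
- apply/pred0P => x /=; rewrite !inE ?hornerX; apply/negP => /andP[/andP[_ /eqP ->]].
  by rewrite neqN // andbF.
- by rewrite xx.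
- by rewrite xx.
- apply/pred0P => x /=; rewrite !inE ?hornerX; apply/negP => /andP[/andP[/eqP -> _]].
  by rewrite neqN.
- by rewrite !hornerE exprMn fx xx mulrC.
- by rewrite !hornerE exprMn fx xx mulrNN mulrC.
apply/pred0P => x /=; rewrite !inE ?hornerX; apply/negP => /andP[/andP[/eqP -> _]].
by rewrite neqN.
Qed.

(** Away from the roots of X f both characters take the values 1 and -1 only. *)
Lemma quadrant_total (F : finFieldType) h (f : {poly F}) m (a b : F) :
  #|F| = h.*2.+1 -> a ^+ 2 = 1 -> b ^+ 2 = 1 -> f != 0 -> (size f <= m)%N ->
  (#|F| <= #|quadrant h f a b| + #|quadrant h f a (- b)| + #|quadrant h f (- a) b|
           + #|quadrant h f (- a) (- b)| + m.+1)%N.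
Proof.
move=> Fh a2 b2 f0 sf; pose Z := [set x | root ('X * f) x].
have Xf0 : 'X * f != 0 by rewrite mulf_neq0 ?polyX_eq0.
have cZ : (#|Z| <= m.+1)%N.
  have rt : all (root ('X * f)) (enum Z) by apply/allP => x; rewrite mem_enum inE.
  have := max_poly_roots Xf0 rt (enum_uniq _); rewrite -cardE mulrC size_mulX //.
  by move/ltnW/leq_trans; apply.
apply: (@leq_trans #|quadrant h f a b :|: quadrant h f a (- b) :|: quadrant h f (- a) b
                 :|: quadrant h f (- a) (- b) :|: Z|).
  rewrite -cardsT subset_leq_card //; apply/fintype.subsetP => x _; rewrite !inE.
  have [//|] := boolP (root _ x); rewrite ?orbT //.
  rewrite rootE !hornerE mulf_eq0 negb_or => /andP[x0 fx0].
  have mem1 (y c : F) : y != 0 -> c ^+ 2 = 1 -> (y ^+ h == c) || (y ^+ h == - c).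
    move=> y0 /eqP; rewrite sqrf_eq1 => /orP[]/eqP->; rewrite ?opprK 1?orbC.
      by rewrite orbC (exp_half_pm1 Fh).
    by rewrite (exp_half_pm1 Fh).
  have := mem1 _ _ fx0 a2; have := mem1 _ _ x0 b2.
  by case: (_ == b); case: (_ == - b); case: (_ == a); case: (_ == - a).
by do 4! [rewrite (leq_trans (leq_card_setU _ _)) // leq_add //].
Qed.

(** Adding the three bounds of quadrant_sum_le counts the quadrant (a, b) three
    times and the others once, so twice its size plus about p is at most
    3p/2 + o(p).  The lower bound is p minus the upper bounds of the other three. *)
Lemma quadrant_bounds m K : exists N : nat,
  forall (F : finFieldType) (f : {poly F}) (a b : F) h,
  prime #|F| -> #|F| = h.*2.+1 -> (N <= #|F|)%N -> (size f <= m)%N ->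
  not_scaled_square f -> not_scaled_square ('X * f) -> a ^+ 2 = 1 -> b ^+ 2 = 1 ->
  (K * (4 * #|quadrant h f a b|) <= (K + 4) * #|F| /\
   K * #|F| <= K * (4 * #|quadrant h f a b|) + 14 * #|F|)%N.
Proof.
have [N1 HN1] := card_power_fiber_le m K.
have [N2 HN2] := card_power_fiber_le m.+1 K.
exists (N1 + N2 + 2 * (K * m.+1) + 3)%N => F f a b h pr Fh leN sf nsf nsXf.
have h0 : (0 < h)%N by lia.
have f0 : f != 0.
  by apply/eqP => f0; apply: (nsf 0 1 0); rewrite ?oner_neq0 // f0 mul0r scale0r.
have upper (c d : F) : c ^+ 2 = 1 -> d ^+ 2 = 1 ->
    (K * (4 * #|quadrant h f c d|) <= (K + 4) * #|F|)%N.
  move=> c2 d2.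
  have [q1 q2 q3] := quadrant_sum_le f pr Fh c2 d2.
  have tot := quadrant_total Fh c2 d2 f0 sf.
  have B1 : (K * #|power_fiber f h c|.*2 <= K.+1 * #|F|)%N.
    by apply: HN1 => //; lia.
  have B3 : (K * #|power_fiber ('X * f) h (c * d)|.*2 <= K.+1 * #|F|)%N.
    apply: HN2 => //; first by lia.
    by rewrite mulrC size_mulX.
  have B2 := card_power_fiberX_le d h0.
  move: q1 q2 q3 tot B1 B2 B3 leN Fh.
  move: #|quadrant h f c d| #|quadrant h f (- c) d| => n1 n2.
  move: #|quadrant h f c (- d)| #|quadrant h f (- c) (- d)| => n3 n4.
  move: #|F| #|power_fiber f h c| #|power_fiber 'X h d| => q b1 b2.
  move: #|_| => b3 q1 q2 q3 tot B1 B2 B3 leN Fq.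
  have : (K * (4 * n1 + 2 * q) <= K * (b1.*2 + b2.*2 + b3.*2 + 2 * m.+1))%N.
    by rewrite leq_mul2l; apply/orP; right; lia.
  have : (K * b2.*2 <= K * q)%N by rewrite leq_mul2l; apply/orP; right; lia.
  rewrite !mulnDr; lia.
move=> a2 b2; split; first exact: upper.
have tot := quadrant_total Fh a2 b2 f0 sf.
have Na : (- a) ^+ 2 = 1 by rewrite sqrrN.
have Nb : (- b) ^+ 2 = 1 by rewrite sqrrN.
have := upper _ _ Na b2; have := upper _ _ a2 Nb; have := upper _ _ Na Nb.
move: tot leN; move: #|quadrant h f a b| #|quadrant h f (- a) b| => n1 n2.
move: #|quadrant h f a (- b)| #|quadrant h f (- a) (- b)| #|F| => n3 n4 q tot leN.
have : (K * (4 * q) <= K * (4 * (n1 + n3 + n2 + n4 + m.+1)))%N.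
  by rewrite leq_mul2l leq_mul2l tot !orbT.
by rewrite !mulnDr; lia.
Qed.

(** * Integer polynomials that are not a constant times a square *)

(** Gauss's lemma: the primitive part of f is the square of the primitive
    part of h, and f is its content times its primitive part. *)
Lemma int_scaled_square (f h : {poly int}) (N c : int) :
  N != 0 -> N *: f = c *: h ^+ 2 -> exists a g, f = a *: g ^+ 2.
Proof.
move=> N0 E; exists (zcontents f), (zprimitive h).
have [c0|c0] := eqVneq c 0.
  have -> : f = 0 by apply/eqP; move/eqP: E; rewrite c0 scale0r scale_poly_eq0 (negPf N0).
  by rewrite zcontents0 scale0r.
have := congr1 zprimitive E; rewrite !zprimitiveZ // expr2 zprimitiveM -expr2 => <-.
by rewrite -zpolyEprim.
Qed.

(** In characteristic zero an s that is not separable has a factor u^2 with u not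
    constant, which can be moved into h; this makes s smaller.  If s becomes
    constant, then f is an integer times a square. *)
Lemma separable_part (f : {poly int}) :
  ~ (exists (a : int) (g : {poly int}), f = a *: g ^+ 2) ->
  exists (N : int) (s h : {poly int}),
    [/\ N != 0, N *: f = s * h ^+ 2, (1 < size s)%N & separable_poly s].
Proof.
move=> nsq.
suff main n : forall (N : int) (s h : {poly int}), (size s <= n)%N ->
    N != 0 -> N *: f = s * h ^+ 2 -> exists (N : int) (s h : {poly int}),
    [/\ N != 0, N *: f = s * h ^+ 2, (1 < size s)%N & separable_poly s].
  by apply: (main _ 1 f 1 (leqnn _)); rewrite ?oner_neq0 // scale1r expr1n mulr1.
elim: n => [|n IH] N s h szs N0 E.
  move: szs; rewrite leqn0 size_poly_eq0 => /eqP s0; case: nsq; exists 0, 0.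
  by apply/eqP; move/eqP: E; rewrite s0 mul0r scale0r scale_poly_eq0 (negPf N0).
have [s1|s1] := leqP (size s) 1.
  case: nsq; apply: (@int_scaled_square _ h N s`_0) => //.
  by rewrite E (size1_polyC s1) coefC eqxx mul_polyC.
have [sep|nsep] := boolP (separable_poly s); first by exists N, s, h.
have [u dvu szu] : exists2 u, u ^+ 2 %| s & (1 < size u)%N.
  have s0 : s != 0 by rewrite -size_poly_gt0 ltnW.
  apply: contrapT => nex; case/negP: nsep; apply/separable_polyP; split=> [u v dvuv|u dvu szu].
    apply: contraT => ncop; case: nex; exists (gcdp u v).
      by rewrite expr2 (dvdp_trans _ dvuv) // dvdp_mul ?dvdp_gcdl ?dvdp_gcdr.
    rewrite ltn_neqAle eq_sym ncop size_poly_gt0 gcdp_eq0 /=.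
    by apply: contraNN s0 => /andP[/eqP u0 _]; rewrite u0 mul0r dvd0p in dvuv.
  (* The leading coefficient of u' is that of u times deg u. *)
  apply/eqP => /(congr1 (fun r : {poly int} => r`_(size u).-2)); rewrite coef_deriv coef0.
  have -> : (size u).-2.+1 = (size u).-1 by case: (size u) szu => [|[]].
  move/eqP; rewrite mulrn_eq0 -[_`_ _]/(lead_coef u) lead_coef_eq0 -size_poly_eq0.
  by case: (size u) szu => [|[]].
have s0 : s != 0 by rewrite -size_poly_gt0 ltnW.
have /Pdiv.Idomain.dvdpP[[c q] /= c0 Eq] := dvu.
apply: (IH (c * N) q (u * h)); last first.
- by rewrite -scalerA E scalerAl Eq; ring.
- by rewrite mulf_neq0.
have u0 : u != 0 by rewrite -size_poly_gt0 ltnW.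
have q0 : q != 0.
  by apply: contraNneq s0 => q0; move/eqP: Eq; rewrite q0 mul0r scale_poly_eq0 (negPf c0).
have := congr1 (fun r : {poly int} => size r) Eq.
rewrite /= size_scale // size_mul ?expf_neq0 //.
rewrite expr2 size_mul //; move: szu szs s1 q0; rewrite -size_poly_gt0.
by move: (size s) (size u) (size q) => a b d; lia.
Qed.

Lemma separable_dvd_sqr (F : fieldType) (s g : {poly F}) :
  separable_poly s -> s %| g ^+ 2 -> s %| g.
Proof.
move=> seps; set d := gcdp s g.
have [/dvdpP[e Es] /dvdpP[g' Eg]] : d %| s /\ d %| g by rewrite dvdp_gcdl dvdp_gcdr.
have s0 := separable_poly_neq0 seps.
have d0 : d != 0 by apply: contraNneq s0 => e0; rewrite Es e0 mulr0.
have cop : coprimep e g'.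
  have : d * 1 %= d * gcdp e g'.
    rewrite mulr1 eqp_sym (eqp_trans (mulp_gcdr _ _ _)) //.
    by rewrite ![d * _]mulrC -Es -Eg eqpxx.
  rewrite eqp_mul2l // => /eqp_size; rewrite size_poly1 => sz1.
  by rewrite /coprimep -sz1.
have copd : coprimep e d by apply: separable_coprime seps _; rewrite -Es dvdpp.
rewrite Eg => dvd; have : e * d %| d * (d * g' ^+ 2).
  by move: dvd; rewrite Es; congr (_ %| _); ring.
rewrite mulrC dvdp_mul2l // => dve.
(* Here s = e d and g = g' d, so e is coprime to d and to g' but divides d g'^2. *)
have cope : coprimep e (d * g' ^+ 2) by rewrite coprimepMr copd coprimep_expr.
have e1 : e %= 1 by apply: (coprimepP _ _ cope) => //; apply: dvdpp.
by rewrite Es (eqp_dvdl _ (eqp_mulr _ e1)) mul1r dvdp_mull.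
Qed.

(** Infinite descent: from s H^2 = c Q^2 one gets s | Q, then s | H, and the
    quotients solve the same equation with a smaller H. *)
Lemma separable_not_scaled_square (F : fieldType) (s h : {poly F}) :
  separable_poly s -> (1 < size s)%N -> h != 0 -> not_scaled_square (s * h ^+ 2).
Proof.
move=> seps szs h0 c P Q P0; rewrite -mulrA -exprMn.
have : h * P != 0 by rewrite mulf_neq0.
move: (h * P) => {h0 P0 P}H H0.
have [n] := ubnP (size H); elim: n H Q H0 => // n IH H Q H0 szH E.
have s0 : s != 0 by rewrite -size_poly_gt0 ltnW.
have c0 : c != 0.
  apply/eqP => c0; move/eqP: E; rewrite c0 scale0r mulf_eq0 expf_eq0 /=.
  by rewrite (negPf s0) (negPf H0).
have /(separable_dvd_sqr seps)/dvdpP[Q1 EQ] : s %| Q ^+ 2.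
  by rewrite -(dvdpZr _ _ c0) -E dvdp_mulr.
have EH : H ^+ 2 = c *: (s * Q1 ^+ 2).
  by apply: (mulfI s0); rewrite E EQ -!mul_polyC; ring.
have /(separable_dvd_sqr seps)/dvdpP[H1 EH1] : s %| H ^+ 2.
  by rewrite EH dvdpZr ?dvdp_mulr.
have H10 : H1 != 0 by apply: contraNneq H0 => e; rewrite EH1 e mul0r.
apply: (IH H1 Q1) => //.
  rewrite -ltnS (leq_trans _ szH) // EH1 size_mul //.
  by move: (size H1) (size s) szs => b d; lia.
by apply: (mulfI s0); rewrite -[_ *: _ in RHS]/(c *: Q1 ^+ 2) -scalerAr -EH EH1; ring.
Qed.

Lemma int_Fp_neq0 (x : int) p : prime p -> x != 0 -> (`|x| < p)%N -> (x%:~R : 'F_p) != 0.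
Proof.
move=> pr x0 xp; rewrite -(dvdz_pcharf (pchar_Fp pr)) dvdzE /=.
by apply/negP => /dvdn_leq; rewrite absz_gt0 x0 leqNgt xp => /(_ isT).
Qed.

Lemma size_map_poly_intr (u : {poly int}) p :
  prime p -> u != 0 -> (`|lead_coef u| < p)%N ->
  size (map_poly intr u : {poly 'F_p}) = size u.
Proof.
by move=> pr u0 up; apply: size_map_poly_id0; apply: int_Fp_neq0; rewrite ?lead_coef_eq0.
Qed.

(** Unlike coprimality over Z[X], an identity with a nonzero constant D survives
    reduction modulo every prime that does not divide D. *)
Lemma separable_Bezout (s : {poly int}) : separable_poly s ->
  exists (u v : {poly int}) (D : int), D != 0 /\ u * s + v * s^`() = D%:P.
Proof.
rewrite separable_poly.unlock -gcdp_eqp1 => gs1.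
have [[u v] /= uv] := Pdiv.Idomain.Bezoutp s s^`().
have /eqpP[[c D] /= /andP[c0 D0] E] := eqp_trans uv gs1.
by exists (c *: u), (c *: v), D; rewrite -!scalerAl -scalerDr E alg_polyC.
Qed.

Lemma not_scaled_square_mod_p (f : {poly int}) :
  ~ (exists (a : int) (g : {poly int}), f = a *: g ^+ 2) ->
  exists N : nat, forall p, prime p -> (N <= p)%N ->
    not_scaled_square (map_poly intr f : {poly 'F_p}).
Proof.
move=> nsq; have [N [s [h [N0 E szs seps]]]] := separable_part nsq.
have s0 : s != 0 by rewrite -size_poly_gt0 ltnW.
have h0 : h != 0.
  apply/eqP => h0; apply: nsq; exists 0, 0; rewrite scale0r; apply/eqP; move/eqP: E.
  by rewrite h0 expr0n mulr0 scale_poly_eq0 (negPf N0).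
have [u [v [D [D0 uvD]]]] := separable_Bezout seps.
exists (`|N| + `|D| + `|lead_coef s| + `|lead_coef h|).+1%N => p pr leNp.
have [ltD lts lth] : [/\ `|D| < p, `|lead_coef s| < p & `|lead_coef h| < p]%N.
  move: leNp; move: (`|N|)%N (`|D|)%N (`|lead_coef s|)%N (`|lead_coef h|)%N.
  by move=> a b d e; split; lia.
pose red (q : {poly int}) : {poly 'F_p} := map_poly intr q.
have sep_p : separable_poly (red s).
  rewrite separable_poly.unlock; apply/Bezout_eq1_coprimepP.
  have Dp : (D%:~R : 'F_p) != 0 by apply: int_Fp_neq0.
  exists (D%:~R^-1 *: red u, D%:~R^-1 *: red v) => /=.
  rewrite /red deriv_map -!scalerAl -scalerDr -!rmorphM -rmorphD uvD /= map_polyC /=.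
  by rewrite -mul_polyC -polyCM mulVf.
have szs_p : (1 < size (red s))%N by rewrite size_map_poly_intr.
have h0_p : red h != 0.
  by rewrite -size_poly_gt0 size_map_poly_intr ?size_poly_gt0.
move=> c P Q P0 EPQ.
apply: (separable_not_scaled_square sep_p szs_p h0_p (c := N%:~R * c) (Q := Q) P0).
have := congr1 red E; rewrite /red map_polyZ rmorphM rmorphXn /= => <-.
by rewrite -scalerAl EPQ scalerA.
Qed.

Lemma X_mul_scaled_square (f : {poly int}) :
  (exists (a : int) (g : {poly int}), 'X * f = a *: g ^+ 2) ->
  exists (a : int) (g : {poly int}), f = a *: ('X * g ^+ 2).
Proof.
move=> [a [g E]].
have [a0|a0] := eqVneq a 0.
  exists 0, 0; rewrite scale0r; apply/eqP; move/eqP: E.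
  by rewrite a0 scale0r mulf_eq0 polyX_eq0.
have g0 : root g 0.
  have /eqP := congr1 (horner^~ 0) E; rewrite /= hornerM hornerX mul0r eq_sym.
  by rewrite hornerZ horner_exp mulf_eq0 (negPf a0) expf_eq0.
have [g1 Eg] := factor_theorem g 0 g0; rewrite subr0 in Eg.
exists a, g1; apply: (mulfI (x := 'X)); first by rewrite polyX_eq0.
by rewrite E Eg -!mul_polyC; ring.
Qed.

(** * Quadratic classes modulo p, and the limit *)

Lemma quad_class1E p h : prime p -> p = h.*2.+1 -> (0 < h)%N ->
  quad_class p 1 = power_fiber 'X h 1.
Proof.
move=> pr Fh h0; apply/setP => y; rewrite /quad_class eqxx !inE hornerX.
by rewrite (euler_criterion _ h0) // card_Fp.
Qed.

Lemma quad_classN1E p h : prime p -> p = h.*2.+1 -> (0 < h)%N ->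
  quad_class p (-1) = power_fiber 'X h (-1).
Proof.
move=> pr ph h0; apply/setP => y; rewrite /quad_class eqxx /= !inE hornerX.
have Fh : #|'F_p| = h.*2.+1 by rewrite card_Fp.
have prF : prime #|'F_p| by rewrite card_Fp.
have [->|y0] := eqVneq y 0.
  rewrite expr0n eqn0Ngt h0 /= eq_sym oppr_eq0 oner_eq0; apply/negbF.
  by apply/existsP; exists 0; rewrite expr0n.
have := euler_criterion y h0 Fh; rewrite y0 /= /is_square => <-.
have /orP[/eqP->|/eqP->] := exp_half_pm1 Fh y0; rewrite eqxx.
  by rewrite (oner_neqN1_odd_card prF Fh).
by rewrite eq_sym (oner_neqN1_odd_card prF Fh).
Qed.

Lemma quad_countE (f : {poly int}) (i j : int) p h :
  prime p -> p = h.*2.+1 -> (0 < h)%N -> i = 1 \/ i = -1 -> j = 1 \/ j = -1 ->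
  quad_count f i j p = #|quadrant h (map_poly intr f : {poly 'F_p}) i%:~R j%:~R|.
Proof.
move=> pr ph h0 hi hj.
have cl (k : int) : k = 1 \/ k = -1 -> quad_class p k = power_fiber 'X h k%:~R.
  by case=> ->; rewrite ?mulrN1z ?mulr1z; [exact: quad_class1E | exact: quad_classN1E].
rewrite /quad_count !cl //; apply: eq_card => y.
by rewrite !inE /eval_mod !hornerX.
Qed.

Unset Implicit Arguments.
Local Open Scope classical_set_scope.

Theorem corollary1p1 (R : realType) (f : {poly int})
    (f_not_square :
      ~ exists (a : int) (g : {poly int}), f = a *: g ^+ 2)
    (f_not_Xsquare :
      ~ exists (a : int) (g : {poly int}), f = a *: ('X * g ^+ 2))
    (i j : int) (hi : i = 1 \/ i = -1) (hj : j = 1 \/ j = -1) :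
  (quad_count f i j p)%:R / p%:R @[p --> within [set p : nat | prime p] \oo]
    --> (1 / 4 : R).
Proof.
have [N1 HN1] := not_scaled_square_mod_p f_not_square.
have [N2 HN2] := not_scaled_square_mod_p (contra_not (@X_mul_scaled_square f) f_not_Xsquare).
apply/cvgrPdist_le => e e0.
(* 4 n will differ from p by at most 14 p / K, hence n / p from 1/4 by at most
   3.5 / K < e. *)
pose K := (Num.truncn (4 / e)).+1.
have [N3 HN3] := quadrant_bounds (size f) K.
exists (N1 + N2 + N3 + 3)%N => // p /= leNp pr.
have [h ph] : exists h, p = h.*2.+1.
  exists p./2; have := odd_double_half p; case: (even_prime pr) => [p2|->] //.
  by move: leNp; rewrite p2; lia.
have h0 : (0 < h)%N by lia.
have sq1 (k : int) : k = 1 \/ k = -1 -> (k%:~R : 'F_p) ^+ 2 = 1.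
  by case=> ->; rewrite ?mulrN1z ?sqrrN expr1n.
rewrite (quad_countE f pr ph h0 hi hj) //.
have := HN3 'F_p (map_poly intr f) i%:~R j%:~R h; rewrite card_Fp //.
case=> //.
- by lia.
- by rewrite size_poly.
- by apply: HN1 => //; lia.
- have -> : 'X * map_poly intr f = map_poly intr ('X * f) :> {poly 'F_p}.
    by rewrite rmorphM /= map_polyX.
  by apply: HN2 => //; lia.
- exact: sq1.
- exact: sq1.
move: #|quadrant _ _ _ _| => n up lo.
have p0 : 0 < p%:R :> R by rewrite ltr0n prime_gt0.
have K0 : 0 < K%:R :> R by rewrite ltr0n.
have Ke : 4 <= K%:R * e.
  rewrite -ler_pdivrMr // ltW // /K; exact: truncnS_gt.
clearbody K; move: up lo; rewrite -!(ler_nat R) [X in _ -> _ <= X -> _]natrD !natrM natrD.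
move: (K%:R : R) p%:R (n%:R) p0 K0 Ke => k q x q0 k0 ke up lo.
have keq : 4 * q <= k * e * q by rewrite ler_pM2r.
have hi4 : 4 * x - q <= 4 * e * q by rewrite -(ler_pM2l k0); nra.
have lo4 : q - 4 * x <= 4 * e * q by rewrite -(ler_pM2l k0); nra.
have Ex : 1 / 4 - x / q = (q - 4 * x) / (4 * q) by field; rewrite gt_eqF.
rewrite Ex normrM [`|_^-1|]gtr0_norm ?invr_gt0 ?mulr_gt0 // ler_pdivrMr ?mulr_gt0 //.
by rewrite ler_norml; apply/andP; split; nra.
Qed.
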